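(* Let ${\bf E}$ be the $n$-dimensional evolution algebra over $\mathbb K$ with natural basis $\{{\bf e}_1,\dots,{\bf e}_n\}$ and ${\bf e}_i^2={\bf e}_{i+1}$ for $i<n$, ${\bf e}_n^2={\bf 0}$. Let $R\in\mathcal{RB}_1^{\blacktriangle}({\bf E})$ with $R({\bf e}_i)=\sum_{k=1}^n r_{i,k}{\bf e}_k$, and put $\beta_i=r_{1,i}$ for $i>1$. Then for all $1<i<j\le n$, $$r_{i,j}=\begin{cases}\beta_{j-i+1}^{2^{i-1}}, & \text{if } r_{1,1}=0,\\[1mm] -\beta_{j-i+1}^{2^{i-1}}, & \text{if } r_{1,1}=-1.\end{cases}$$
   Context: $\mathbb K$ is $\mathbb R$ or $\mathbb C$. An evolution algebra over $\mathbb K$ with natural basis $\{{\bf e}_i\}$ is an algebra with bilinear multiplication such that ${\bf e}_i{\bf e}_j={\bf 0}$ for $i\ne j$ and each ${\bf e}_i^2$ is a linear combination of basis vectors. A linear map $R:{\bf E}\to{\bf E}$ is a Rota-Baxter operator of weight $1$ if $R({\bf x})R({\bf y})=R(R({\bf x}){\bf y}+{\bf x}R({\bf y})+{\bf x}{\bf y})$ for all ${\bf x},{\bf y}\in{\bf E}$; such operators on ${\bf E}$ satisfy $r_{i,k}=0$ for $k<i$. $\mathcal{RB}_1^{\blacktriangle}({\bf E})$ denotes the set of Rota-Baxter operators of weight $1$ on ${\bf E}$ for which $r_{i,j}\neq 0$ for some $i<j<n$; for these, all diagonal entries $r_{i,i}$ are equal, with common value $0$ or $-1$. *)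

(* Defs.v *)
From HB Require Import structures.
From mathcomp Require Import all_boot all_order all_algebra.
From mathcomp Require Import reals complex.

Set Implicit Arguments.
Unset Strict Implicit.
Unset Printing Implicit Defensive.

Import GRing.Theory.
Local Open Scope ring_scope.

Inductive ground := GroundReal | GroundComplex.

Definition ground_field (Rl : realType) (g : ground) : fieldType :=
  match g with
  | GroundReal => Rl : fieldType
  | GroundComplex => Rl[i] : fieldType
  end.

(* Basis vectors are indexed from 1: only e 1, ..., e n are meaningful, and
   values of e (or of a coefficient family r) outside 1..n play no role. *)
Definition indexed_basis (K : fieldType) (E : vectType K) (n : nat)
    (e : nat -> E) : Prop :=
  basis_of fullv [seq e i | i <- iota 1 n].

(* That each e_i ^ 2 is a linear combination of e_1, ..., e_n needs no clause
   of its own, since these vectors span E. *)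
Definition natural_basis (K : fieldType) (E : vectType K)
    (mul : {bilinear E -> E -> E}) (n : nat) (e : nat -> E) : Prop :=
  indexed_basis n e /\
  forall i j : nat, (1 <= i <= n)%N -> (1 <= j <= n)%N -> i != j ->
    mul (e i) (e j) = 0.

Definition chain_evolution_algebra (K : fieldType) (E : vectType K)
    (mul : {bilinear E -> E -> E}) (n : nat) (e : nat -> E) : Prop :=
  [/\ natural_basis mul n e,
      forall i : nat, (1 <= i < n)%N -> mul (e i) (e i) = e i.+1 &
      mul (e n) (e n) = 0].

Definition rota_baxter1 (K : fieldType) (E : vectType K)
    (mul : {bilinear E -> E -> E}) (R : {linear E -> E}) : Prop :=
  forall x y : E,
    mul (R x) (R y) = R (mul (R x) y + mul x (R y) + mul x y).

(* R (e_i) = \sum_k r_{i,k} e_k: the coefficients of the image of e_i form the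
   i-th row of r. *)
Definition coefficients_of (K : fieldType) (E : vectType K) (n : nat)
    (e : nat -> E) (R : {linear E -> E}) (r : nat -> nat -> K) : Prop :=
  forall i : nat, (1 <= i <= n)%N ->
    R (e i) = \sum_(1 <= k < n.+1) r i k *: e k.

(* When e is a basis, r is determined by R on the index range 1..n, so the
   existential over r merely names the matrix of R. *)
Definition RB1_triangle (K : fieldType) (E : vectType K)
    (mul : {bilinear E -> E -> E}) (n : nat) (e : nat -> E)
    (R : {linear E -> E}) : Prop :=
  rota_baxter1 mul R /\
  exists r : nat -> nat -> K,
    coefficients_of n e R r /\
    exists i j : nat, [/\ (1 <= i)%N, (i < j)%N, (j < n)%N & r i j != 0].

(* Main.v *)
Require Import Defs.
From HB Require Import structures.
From mathcomp Require Import all_boot all_order all_algebra.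
From mathcomp Require Import reals complex.

Set Implicit Arguments.
Unset Strict Implicit.
Unset Printing Implicit Defensive.

Import GRing.Theory.
Local Open Scope ring_scope.

(** Apply the Rota-Baxter identity to the pair (e_i, e_i) with i < n.  Only
    squares of basis vectors survive, so it reads
    [\sum_(k < n) r_{i,k}^2 e_{k+1} = (2 r_{i,i} + 1) R(e_{i+1})],
    and comparing coordinates at e_{k+1} gives
    [(2 r_{i,i} + 1) r_{i+1,k+1} = r_{i,k}^2] (lemma [square_recursion]).

    Let s = 2 r_{1,1} + 1, which is 1 or -1 according to r_{1,1} = 0 or -1.
    Then [s * r_{1,1}^2 = r_{1,1}], so the case k = i of the recursion carries
    the value r_{1,1} down the whole diagonal, and the recursion becomes
    [r_{i+1,k+1} = s * r_{i,k}^2] in every row (lemma [diagonal_recursion]).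
    Moving along a diagonal of the matrix thus squares the entry and multiplies
    it by s; as s^2 = 1, the factors s do not accumulate, and m > 0 steps
    starting from r_{1,l} give [s * r_{1,l} ^ (2 ^ m)]
    (lemma [diagonal_iterated_squares]). *)

Section ChainRotaBaxter.

Variables (K : fieldType) (E : vectType K) (mul : {bilinear E -> E -> E}).
Variables (n : nat) (e : nat -> E).

Lemma indexed_basis_coord (a b : nat -> K) :
    indexed_basis n e ->
    \sum_(1 <= k < n.+1) a k *: e k = \sum_(1 <= k < n.+1) b k *: e k ->
  forall k, (1 <= k <= n)%N -> a k = b k.
Proof.
move=> /basis_free free_e eq_ab [//|k] /= lt_kn.
have /freeP indep : free (map_tuple e (iota_tuple n 1)) by [].
suff /indep/(_ (Ordinal lt_kn)) /= /eqP :
    \sum_(i < n) (a i.+1 - b i.+1) *: (map_tuple e (iota_tuple n 1))`_i = 0.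
  by rewrite subr_eq0 => /eqP.
move/eqP: eq_ab; rewrite -subr_eq0 -sumrB big_add1 big_mkord => /eqP eq_ab.
rewrite -[RHS]eq_ab; apply: eq_bigr => i _.
by rewrite /= (nth_map 0%N) ?size_iota // nth_iota // add1n scalerBl.
Qed.

Section NaturalBasis.

Hypothesis natural_e : natural_basis mul n e.

Lemma mul_basis_sum (b : nat -> K) i : (1 <= i <= n)%N ->
  mul (e i) (\sum_(1 <= k < n.+1) b k *: e k) = b i *: mul (e i) (e i).
Proof.
move=> i_in; rewrite linear_sumr (bigD1_seq i) ?mem_index_iota ?iota_uniq //=.
rewrite linearZr_LR big_seq_cond big1 ?addr0 // => k /andP[].
rewrite mem_index_iota ltnS => k_in k_neq_i.
by rewrite linearZr_LR natural_e.2 ?scaler0 // eq_sym.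
Qed.

Lemma mul_sum_basis (a : nat -> K) i : (1 <= i <= n)%N ->
  mul (\sum_(1 <= k < n.+1) a k *: e k) (e i) = a i *: mul (e i) (e i).
Proof.
move=> i_in; rewrite linear_sumlz (bigD1_seq i) ?mem_index_iota ?iota_uniq //=.
rewrite linearZl_LR big_seq_cond big1 ?addr0 // => k /andP[].
rewrite mem_index_iota ltnS => k_in k_neq_i.
by rewrite linearZl_LR natural_e.2 ?scaler0.
Qed.

Lemma sqr_sum_basis (a : nat -> K) :
  mul (\sum_(1 <= k < n.+1) a k *: e k) (\sum_(1 <= k < n.+1) a k *: e k)
    = \sum_(1 <= k < n.+1) a k ^+ 2 *: mul (e k) (e k).
Proof.
rewrite linear_sumlz; apply: eq_big_nat => k k_in.
by rewrite linearZl_LR mul_basis_sum // scalerA.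
Qed.

End NaturalBasis.

Hypothesis chain_e : chain_evolution_algebra mul n e.

(** Squaring shifts the coordinates by one place: the first coordinate of a
    square is 0, and the last coordinate of the argument is lost because the
    square of e_n vanishes. *)
Lemma sqr_sum_chain (a : nat -> K) :
  mul (\sum_(1 <= k < n.+1) a k *: e k) (\sum_(1 <= k < n.+1) a k *: e k)
    = \sum_(1 <= k < n.+1) (if (k <= 1)%N then 0 else a k.-1 ^+ 2) *: e k.
Proof.
case: (chain_e) => natural_e chain_sqr last_sqr.
rewrite (sqr_sum_basis natural_e).
have [n0|n_gt0] := posnP n; first by rewrite !big_geq ?n0.
rewrite [LHS]big_nat_recr //= last_sqr scaler0 addr0.
rewrite [RHS]big_ltn //= scale0r add0r [RHS]big_add1 /=.
by apply: eq_big_nat => k k_in; rewrite chain_sqr // ltnNge (andP k_in).1.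
Qed.

Variables (R : {linear E -> E}) (r : nat -> nat -> K).
Hypothesis RB_R : rota_baxter1 mul R.
Hypothesis coef_R : coefficients_of n e R r.

(** The coordinate at e_{k+1} of the Rota-Baxter identity for (e_i, e_i). *)
Lemma square_recursion i k : (1 <= i < n)%N -> (1 <= k < n)%N ->
  (r i i *+ 2 + 1) * r i.+1 k.+1 = r i k ^+ 2.
Proof.
case: (chain_e) => natural_e chain_sqr _ /[dup] i_in /andP[i_gt0 lt_in].
move=> /andP[k_gt0 lt_kn].
have i_le : (1 <= i <= n)%N by rewrite i_gt0 ltnW.
have := RB_R (e i) (e i); rewrite coef_R // sqr_sum_chain.
rewrite mul_sum_basis // mul_basis_sum // chain_sqr //.
rewrite -[X in _ + X]scale1r -!scalerDl linearZ /= coef_R // scaler_sumr.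
under [in RHS]eq_bigr do rewrite scalerA.
move/(indexed_basis_coord natural_e.1)/(_ k.+1 lt_kn) => /=.
by rewrite ltnS leqNgt k_gt0 /= mulr2n => <-.
Qed.

Hypothesis r11 : r 1 1 = 0 \/ r 1 1 = -1.

Local Notation s := (r 1 1 *+ 2 + 1).

Lemma sign_sqr : s * s = 1.
Proof.
by case: r11 => ->; rewrite ?mul0rn ?add0r ?mulr1 // mulr2n addrNK mulrNN mulr1.
Qed.

Lemma sign_fixes_diagonal : s * r 1 1 ^+ 2 = r 1 1.
Proof.
case: r11 => ->; first by rewrite expr0n mulr0.
by rewrite sqrrN expr1n mulr1 mulr2n addrNK.
Qed.

Lemma constant_diagonal i : (1 <= i <= n)%N -> r i i = r 1 1.
Proof.
elim: i => [//|[//|i] IHi] /= lt_in.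
have le_in : (1 <= i.+1 <= n)%N by exact: ltnW.
have := @square_recursion i.+1 i.+1 lt_in lt_in; rewrite (IHi le_in) => rec.
by rewrite -[LHS]mul1r -sign_sqr -mulrA rec sign_fixes_diagonal.
Qed.

Lemma diagonal_recursion i k : (1 <= i < n)%N -> (1 <= k < n)%N ->
  r i.+1 k.+1 = s * r i k ^+ 2.
Proof.
move=> /[dup] i_in /andP[i_gt0 /ltnW le_in] k_in.
rewrite -(square_recursion i_in k_in) constant_diagonal ?i_gt0 //.
by rewrite mulrA sign_sqr mul1r.
Qed.

Lemma diagonal_iterated_squares m l : (0 < l)%N -> (l + m.+1 <= n)%N ->
  r m.+2 (l + m.+1)%N = s * r 1 l ^+ (2 ^ m.+1).
Proof.
move=> l_gt0; elim: m => [|m IHm]; rewrite addnS => le_n.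
  rewrite addn0 in le_n *.
  by rewrite diagonal_recursion ?l_gt0 // (leq_ltn_trans l_gt0).
have le_mn : (m.+2 < n)%N.
  by apply: leq_ltn_trans le_n; rewrite -[m.+2]add1n leq_add2r.
rewrite diagonal_recursion ?le_mn ?ltn_addr // IHm 1?ltnW //.
by rewrite exprMn [s ^+ 2]sign_sqr mul1r -exprM [in RHS]expnS mulnC.
Qed.

End ChainRotaBaxter.

Theorem mainTheorem7 (Rl : realType) (g : ground) (n : nat)
    (E : vectType (ground_field Rl g)) (mul : {bilinear E -> E -> E})
    (e : nat -> E) (hE : chain_evolution_algebra mul n e)
    (R : {linear E -> E}) (hR : RB1_triangle mul n e R)
    (r : nat -> nat -> ground_field Rl g) (hr : coefficients_of n e R r)
    (beta : nat -> ground_field Rl g)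
    (hbeta : forall i : nat, (1 < i <= n)%N -> beta i = r 1%N i) :
  forall i j : nat, (1 < i)%N -> (i < j)%N -> (j <= n)%N ->
    (r 1%N 1%N = 0 -> r i j = beta (j - i + 1)%N ^+ (2 ^ (i - 1))) /\
    (r 1%N 1%N = -1 -> r i j = - beta (j - i + 1)%N ^+ (2 ^ (i - 1))).
Proof.
move=> [//|[//|m]] j _ lt_mj le_jn; rewrite subn1 /=.
have j_eq : (j - m.+2 + 1 + m.+1)%N = j by rewrite -addnA add1n subnK // ltnW.
set l := (j - m.+2 + 1)%N in j_eq *.
have l_gt1 : (1 < l)%N by rewrite /l addn1 ltnS subn_gt0.
have le_ln : (l <= n)%N by rewrite (leq_trans _ le_jn) // -j_eq leq_addr.
have entry (r11 : r 1 1 = 0 \/ r 1 1 = -1) :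
    r m.+2 j = (r 1 1 *+ 2 + 1) * beta l ^+ (2 ^ m.+1).
  rewrite hbeta ?l_gt1 // -[in LHS]j_eq.
  by apply: (diagonal_iterated_squares hE hR.1 hr r11); rewrite ?j_eq // ltnW.
split=> r11; first by rewrite (entry (or_introl r11)) r11 mul0rn add0r mul1r.
by rewrite (entry (or_intror r11)) r11 mulr2n addrNK mulN1r.
Qed.
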